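(* Let $P$ be a countable dcpo satisfying $\sigma(P\times P)=\sigma(P)\times\sigma(P)$. Then the Scott space $\Sigma P$ is sober if and only if the following holds: whenever $A\in\operatorname{Irr}_c(\Sigma P)$, $x\in A$, and $y_0\le y_1\le\cdots$ is a sequence in $P$ with supremum $y$, \[ \bigl(\forall n\in\mathbb N\ \exists a_n\in A:\ x\le a_n,\ y_n\le a_n\bigr)\ \Longrightarrow\ \exists a\in A:\ x\le a,\ y\le a. \]
   Context: All posets and directed sets are nonempty; countable sets may be finite; $\mathbb N=\{0,1,2,\ldots\}$. A subset $D$ of a poset is directed if any two of its elements have a common upper bound in $D$. A dcpo is a poset in which every directed subset has a supremum. Write $\mathord{\downarrow}x=\{y:y\le x\}$. For a dcpo $P$, an upper set $U\subseteq P$ is Scott open if for every directed $D\subseteq P$, $\bigvee D\in U$ implies $D\cap U\neq\emptyset$; the Scott open sets form the Scott topology $\sigma(P)$, and $\Sigma P=(P,\sigma(P))$ is the Scott space. A nonempty Scott-closed set $A$ is irreducible if any two open sets meeting $A$ have an intersection meeting $A$; $\operatorname{Irr}_c(\Sigma P)$ is the set of irreducible Scott-closed sets. $\Sigma P$ is sober if each $A\in\operatorname{Irr}_c(\Sigma P)$ equals $\mathord{\downarrow}a$ for a unique $a\in P$. $\sigma(P\times P)$ is the Scott topology of the coordinatewise order on $P\times P$, and $\sigma(P)\times\sigma(P)$ denotes the ordinary product topology. *)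

(* Defs.v *)
From HB Require Import structures.
From mathcomp Require Import all_boot all_order.
From mathcomp Require Import boolp classical_sets functions cardinality filter.
From mathcomp Require Import topology.

Set Implicit Arguments.
Unset Strict Implicit.
Unset Printing Implicit Defensive.

Import Order.TTheory.
Local Open Scope classical_set_scope.
Local Open Scope order_scope.

Section Posets.
Context {d : Order.disp_t} {P : porderType d}.
Implicit Types D U : set P.

Definition directed D : Prop :=
  D !=set0 /\
  forall x y, D x -> D y -> exists z, [/\ D z, x <= z & y <= z].

Definition upper_set U : Prop := forall x y, x <= y -> U x -> U y.

Definition down (x : P) : set P := [set y | y <= x].

(* Meaningful on any poset: only those directed sets that have a supremum are
   constrained, which on a dcpo is all of them. *)
Definition scott_open : set_system P := [set U |
  upper_set U /\
  forall D s, directed D -> isLub D s -> U s -> D `&` U !=set0].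

Lemma scott_openT : scott_open setT.
Proof. by split=> // D s [D0 _] _ _; rewrite setIT. Qed.

Lemma scott_openI (U V : set P) :
  scott_open U -> scott_open V -> scott_open (U `&` V).
Proof.
move=> [uU oU] [uV oV]; split.
  by move=> x y xy [Ux Vx]; split; [exact: uU Ux|exact: uV Vx].
move=> D s dD Ds [Us Vs].
have [a [Da Ua]] := oU D s dD Ds Us.
have [b [Db Vb]] := oV D s dD Ds Vs.
have [c [Dc ac bc]] := dD.2 a b Da Db.
by exists c; split=> //; split; [exact: uU Ua|exact: uV Vb].
Qed.

Lemma scott_open_bigU (I : Type) (F : I -> set P) :
  (forall i, scott_open (F i)) -> scott_open (\bigcup_i F i).
Proof.
move=> oF; split.
  by move=> x y xy [i _ Fx]; exists i => //; exact: (oF i).1 Fx.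
move=> D s dD Ds [i _ Fs].
have [a [Da Fa]] := (oF i).2 D s dD Ds Fs.
by exists a; split=> //; exists i.
Qed.

End Posets.

Definition is_dcpo {d : Order.disp_t} (P : porderType d) : Prop :=
  forall D : set P, directed D -> exists s, isLub D s.

(* The Scott space of P: an alias of the carrier of P, so that its topology is
   not attached to the poset itself. *)
Definition scott {d : Order.disp_t} (P : porderType d) : Type := P.

HB.instance Definition _ d (P : porderType d) := Order.POrder.on (scott P).
HB.instance Definition _ d (P : porderType d) :=
  isOpenTopological.Build (scott P)
    (@scott_openT d P) (@scott_openI d P) (@scott_open_bigU d P).

Lemma open_scottE d (P : porderType d) :
  (open : set_system (scott P)) = scott_open.
Proof. by []. Qed.

Definition Irr_c (T : topologicalType) : set (set T) := [set A |
  [/\ A !=set0, closed A &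
      forall U V : set T, open U -> open V ->
        A `&` U !=set0 -> A `&` V !=set0 -> A `&` (U `&` V) !=set0]].

Definition scott_sober {d : Order.disp_t} (P : porderType d) : Prop :=
  forall A : set (scott P), Irr_c A -> exists! a : P, A = down a.

(* Main.v *)
Require Import Defs.
From mathcomp Require Import all_boot all_order.
From mathcomp Require Import boolp classical_sets functions cardinality filter.
From mathcomp Require Import topology.

Set Implicit Arguments.
Unset Strict Implicit.
Unset Printing Implicit Defensive.

Import Order.TTheory.
Local Open Scope classical_set_scope.
Local Open Scope order_scope.

(** For an irreducible Scott-closed set [A], let [B] be the union of the squares
    [down a `*` down a] over [a] in [A]. By irreducibility every open rectangle
    meeting [A `*` A] meets [B], so [A `*` A] is contained in the closure of [B]
    for the product topology. Since [P `*` P] is countable, its directed sets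
    have cofinal chains, and two applications of the chain condition (one per
    coordinate) make [B] Scott closed. As the two topologies coincide,
    [A `*` A] is contained in [B]: thus [A] is directed and [A] is the down-set
    of its supremum. *)

(** An injection [f] codes the elements of [D] by naturals; directedness lets the chain, at stage
    [n], climb above the element with code [n]. *)
Lemma countable_directed_cofinal_chain (d : Order.disp_t) (P : porderType d)
    (D : set P) :
  countable D -> directed D ->
  exists c : nat -> P, [/\ forall n, D (c n), forall n, c n <= c n.+1 &
    forall p, D p -> exists n, p <= c n].
Proof.
move=> /countable_injP[f f_inj] [[c0 Dc0] dD].
(* The pair holds the stage and the current term. The guard [D np.2] makes the relation total, as
   choice requires; if no element of [D] has code [n], the chain stays put. *)
have step (np : nat * P) : exists q, D np.2 ->
    [/\ D q, np.2 <= q & forall p, D p -> f p = np.1 -> p <= q].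
  case: np => n p /=; have [Dp|nDp] := pselect (D p); last by exists p.
  have [[r [Dr fr]]|nr] := pselect (exists r, D r /\ f r = n).
    have [q [Dq pq rq]] := dD _ _ Dp Dr; exists q => _; split=> // s Ds fs.
    by rewrite (f_inj s r) ?inE // fs fr.
  by exists p => _; split=> // s Ds fs; case: nr; exists s.
have [g gP] := choice step.
pose c n := iteri n (fun k p => g (k, p)) c0.
have Dc n : D (c n) by elim: n => //= n /(gP (n, _))[].
exists c; split=> // [n|p Dp]; first by have [] := gP (n, _) (Dc n).
(* Stage [f p] handles [p], and its result is the next term of the chain. *)
by exists (f p).+1; have [_ _] := gP (f p, _) (Dc (f p)); apply.
Qed.

Lemma isLub_cofinal (d : Order.disp_t) (P : porderType d) (D E : set P)
    (s : P) :
  E `<=` D -> (forall p, D p -> exists2 q, E q & p <= q) ->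
  isLub D s -> isLub E s.
Proof.
move=> ED cof [ubs lubs]; split=> [q /ED /ubs//|b ubb].
by apply: lubs => p /cof[q Eq /le_trans]; apply; exact: ubb.
Qed.

Lemma isLub_prod (d1 d2 : Order.disp_t) (P : porderType d1)
    (Q : porderType d2) (D : set (P *p Q)) (s : P *p Q) :
  isLub D s -> isLub (fst @` D) s.1 /\ isLub (snd @` D) s.2.
Proof.
case: s => x y [ubs lubs].
have ub p : D p -> (p.1 <= x) /\ (p.2 <= y).
  by move=> /ubs; rewrite leEprod => /andP.
split; split=> [_ [p /ub[p1 p2]] <- //|b ubb].
(* Keeping [y] as second coordinate makes [(b, y)] an upper bound of [D]. *)
- have : ((x, y) : P *p Q) <= (b, y).
    apply: lubs => p Dp; rewrite leEprod /= (ub p Dp).2 andbT.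
    by apply: ubb; exists p.
  by rewrite leEprod => /andP[].
- have : ((x, y) : P *p Q) <= (x, b).
    apply: lubs => p Dp; rewrite leEprod /= (ub p Dp).1.
    by apply: ubb; exists p.
  by rewrite leEprod => /andP[].
Qed.

Lemma scott_closed_down (d : Order.disp_t) (P : porderType d)
    (A : set (scott P)) (x y : P) :
  closed A -> x <= y -> A y -> A x.
Proof.
rewrite -openC => -[up _] xy Ay; apply: contrapT => nAx.
exact: (up x y xy nAx).
Qed.

Lemma scott_closed_sup (d : Order.disp_t) (P : porderType d)
    (A : set (scott P)) (D : set P) (s : P) :
  closed A -> directed D -> D `<=` A -> isLub D s -> A s.
Proof.
rewrite -openC => -[_ op] dD DA Ds; apply: contrapT => nAs.
by have [p [/DA Ap]] := op D s dD Ds nAs; apply.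
Qed.

Lemma chain_le (d : Order.disp_t) (P : porderType d) (y_ : nat -> P) :
  (forall n, y_ n <= y_ n.+1) -> {homo y_ : m n / (m <= n)%N >-> m <= n}.
Proof.
move=> y_S; apply: homo_leq => //.
by move=> y x z; exact: le_trans.
Qed.

Lemma chain_directed (d : Order.disp_t) (P : porderType d) (y_ : nat -> P) :
  (forall n, y_ n <= y_ n.+1) -> directed (range y_).
Proof.
move=> /chain_le y_le; split; first by exists (y_ 0), 0.
move=> _ _ [m _ <-] [n _ <-]; exists (y_ (maxn m n)).
by split; [exists (maxn m n)|apply/y_le/leq_maxl|apply/y_le/leq_maxr].
Qed.

(** Membership of [(x, y)] in the union of the squares of [down a], for [a] in [A]. *)
Definition bounded_in (d : Order.disp_t) (P : porderType d) (A : set P)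
    (x y : P) : Prop := exists a, [/\ A a, x <= a & y <= a].

Definition chain_condition (d : Order.disp_t) (P : porderType d)
    (A : set P) : Prop :=
  forall (x : P) (y_ : nat -> P) (y : P), A x ->
    (forall n, y_ n <= y_ n.+1) -> isLub (range y_) y ->
    (forall n, bounded_in A x (y_ n)) -> bounded_in A x y.

Lemma bounded_inC (d : Order.disp_t) (P : porderType d) (A : set P)
    (x y : P) : bounded_in A x y -> bounded_in A y x.
Proof. by move=> [a [Aa xa ya]]; exists a. Qed.

Lemma bounded_in_chain_sup (d : Order.disp_t) (P : porderType d)
    (A : set (scott P)) (x_ y_ : nat -> P) (x y : P) :
  closed A -> chain_condition A ->
  (forall n, x_ n <= x_ n.+1) -> (forall n, y_ n <= y_ n.+1) ->
  isLub (range x_) x -> isLub (range y_) y ->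
  (forall n, bounded_in A (x_ n) (y_ n)) -> bounded_in A x y.
Proof.
move=> clA ccA x_S y_S x_x y_y bnd.
have Ax_ n : A (x_ n).
  by have [a [Aa xa _]] := bnd n; exact: scott_closed_down clA xa Aa.
have Ay_ n : A (y_ n).
  by have [a [Aa _ ya]] := bnd n; exact: scott_closed_down clA ya Aa.
(* The second use of the chain condition holds [y] fixed, so [y] must lie in [A]. *)
have Ay : A y.
  apply: scott_closed_sup clA (chain_directed y_S) _ y_y.
  by move=> _ [n _ <-].
(* First limit: [x_ m] is fixed and [n] grows. A bound at index [maxn m n] lies above both [x_ m]
   and [y_ n]. *)
have bx_ m : bounded_in A (x_ m) y.
  apply: (ccA _ y_) => // n; have [a [Aa xa ya]] := bnd (maxn m n).
  exists a; split=> //.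
  - by apply: le_trans xa; apply: (chain_le x_S); exact: leq_maxl.
  - by apply: le_trans ya; apply: (chain_le y_S); exact: leq_maxr.
by apply: bounded_inC; apply: (ccA _ x_) => // n; exact/bounded_inC/bx_.
Qed.

Lemma unbounded_pairs_scott_open (d : Order.disp_t) (P : porderType d)
    (A : set (scott P)) :
  countable [set: P] -> closed A -> chain_condition A ->
  scott_open ([set p | ~ bounded_in A p.1 p.2] : set (P *p P)).
Proof.
move=> cP clA ccA; split.
  move=> p q; rewrite leEprod => /andP[pq1 pq2] nb [a [Aa qa1 qa2]]; apply: nb.
  by exists a; split=> //; [exact: le_trans pq1 qa1|exact: le_trans pq2 qa2].
move=> D s dD Ds nbs; apply: contrapT => nDb; apply: nbs.
have cD : countable D.
  apply: sub_countable (countableX cP cP).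
  by apply: subset_card_le => p _; split.
(* A cofinal chain has the same supremum as [D], and its two projections are chains converging to
   the coordinates of [s]. *)
have [c [Dc c_S cof]] := countable_directed_cofinal_chain cD dD.
have {}Ds : isLub (range c) s.
  apply: isLub_cofinal Ds => [_ [n _ <-]//|p /cof[n pn]].
  by exists (c n) => //; exists n.
have [] := isLub_prod Ds; rewrite !image_comp => Ds1 Ds2.
apply: (bounded_in_chain_sup (x_ := fst \o c) (y_ := snd \o c)) => // n.
- by have := c_S n; rewrite leEprod => /andP[].
- by have := c_S n; rewrite leEprod => /andP[].
- by apply: contrapT => nb; apply: nDb; exists (c n).
Qed.

(** An open rectangle of unbounded pairs around [(x, y)] would, by irreducibility, contain some
    [(a, a)] with [a] in [A], a pair bounded by [a] itself. *)
Lemma Irr_c_bounded_in (d : Order.disp_t) (P : porderType d)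
    (A : set (scott P)) (x y : P) :
  Irr_c A -> A x -> A y ->
  open ([set p | ~ bounded_in A p.1 p.2] : set (scott P * scott P)%type) ->
  bounded_in A x y.
Proof.
move=> [_ _ irrA] Ax Ay; rewrite openE => oN; apply: contrapT => nb.
have [[U V] /= [Ux Vy] UVN] := oN (x, y) nb.
move: Ux Vy; rewrite !nbhsE => -[U' [oU' U'x] U'U] [V' [oV' V'y] V'V].
have [] := irrA U' V' oU' oV'; [by exists x|by exists y|].
move=> a [Aa [U'a V'a]]; apply: (UVN (a, a)); last by exists a.
by split; [exact: U'U|exact: V'V].
Qed.

Lemma scott_closed_directed_principal (d : Order.disp_t) (P : porderType d)
    (A : set (scott P)) :
  is_dcpo P -> closed A -> directed (A : set P) -> exists! a : P, A = Defs.down a.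
Proof.
move=> dcpoP clA dA; have [s As] := dcpoP _ dA; exists s; split.
  apply/seteqP; split=> [x /As.1//|x xs].
  exact: scott_closed_down clA xs (scott_closed_sup clA dA _ As).
move=> t At; apply/le_anti/andP; split.
- by apply: As.2 => x; rewrite At.
- by apply: As.1; rewrite At /Defs.down /=.
Qed.

Theorem corollary5p3 (d : Order.disp_t) (P : porderType d)
    (P_nonempty : [set: P] !=set0) (P_countable : countable [set: P])
    (P_dcpo : is_dcpo P)
    (sigma_prod : (scott_open : set_system (P *p P)) =
                  (open : set_system (scott P * scott P)%type)) :
  scott_sober P <->
  (forall (A : set (scott P)) (x : P) (y_ : nat -> P) (y : P),
     Irr_c A -> A x ->
     (forall n, y_ n <= y_ n.+1) -> isLub (range y_) y ->
     (forall n, exists a, [/\ A a, x <= a & y_ n <= a]) ->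
     exists a, [/\ A a, x <= a & y <= a]).
Proof.
split=> [sober A x y_ y irrA Ax _ y_y bnd|cc A irrA].
  (* The generator [a] of [A] is above [x] and above every [y_ n], hence above [y]. *)
  have [a [Aa _]] := sober A irrA; subst A; exists a; split=> //.
    by rewrite /Defs.down /=.
  by apply: y_y.2 => _ [n _ <-]; have [b [ba _ /le_trans]] := bnd n; apply.
have [A0 clA _] := irrA.
have ccA : chain_condition A by move=> x y_ y; exact: cc.
have := unbounded_pairs_scott_open P_countable clA ccA.
(* Product openness supplies the rectangles on which irreducibility acts. *)
rewrite sigma_prod => oN.
apply: scott_closed_directed_principal => //; split=> // x y Ax Ay.
exact: Irr_c_bounded_in.
Qed.
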